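(* Let $R$ be a normal CTRS over $\mathcal{F}$ and let $R'=\{l\to r\Leftarrow s_1\downarrow n_1;\dots;s_k\downarrow n_k\mid l\to r\Leftarrow s_1\twoheadrightarrow n_1;\dots;s_k\twoheadrightarrow n_k\in R\}$ be the corresponding join CTRS. If $\mathbb{U}_{\mathrm{J}}$ is sound for $R'$, then $\mathbb{U}_{\mathrm{N}}$ is sound for $R$; and if $\mathbb{U}_{\mathrm{J}}$ is sound for $R'$ w.r.t. EV-safe reduction of $\mathbb{U}_{\mathrm{J}}(R')$, then $\mathbb{U}_{\mathrm{N}}$ is sound for $R$ w.r.t. EV-safe reduction of $\mathbb{U}_{\mathrm{N}}(R)$.
   Context: Terms $T(\mathcal{F},\mathcal{V})$, $\mathrm{Var}(\cdot)$ variables occurring, $\mathrm{Pos}_{\mathcal{F}}$/$\mathrm{Pos}_{\mathcal{V}}$ function-symbol/variable positions, $t|_p$ subterm, $p\le q$ prefix order. An oriented conditional rule $l\to r\Leftarrow s_1\twoheadrightarrow t_1;\dots;s_k\twoheadrightarrow t_k$ and a join rule $l\to r\Leftarrow s_1\downarrow t_1;\dots;s_k\downarrow t_k$ have $l\notin\mathcal{V}$. Rewrite relation of a rule set $R$: $\to_R=\bigcup_n\to_{(n),R}$, $\to_{(0),R}=\emptyset$, $\to_{(i+1),R}=\{(C[l\sigma],C[r\sigma])\mid \text{each condition holds for }\sigma\text{ w.r.t. }\to_{(i),R}\}$, where $s\twoheadrightarrow t$ holds if $s\sigma\to^*_{(i),R}t\sigma$ and $s\downarrow t$ holds if $s\sigma$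 and $t\sigma$ have a common $\to^*_{(i),R}$-reduct. $R_u=\{l\to r\mid l\to r\Leftarrow c\in R\}$. A normal CTRS is a set of oriented rules with $\mathrm{Var}(s_i)\subseteq\mathrm{Var}(l)$ in which each $t_i$ (written $n_i$) is a ground normal form w.r.t. $R_u$. $\overrightarrow{\mathrm{Var}(l)}$ is a fixed listing of $\mathrm{Var}(l)$. $\mathbb{U}_{\mathrm{N}}(\rho)=\{l\to U^\rho(s_1,\dots,s_k,\overrightarrow{\mathrm{Var}(l)}),\ U^\rho(n_1,\dots,n_k,\overrightarrow{\mathrm{Var}(l)})\to r\}$ for oriented rules with $k\ge1$ and fresh $U^\rho$; $\mathbb{U}_{\mathrm{J}}(\rho)=\{l\to U^\rho(s_1,t_1,\dots,s_k,t_k,\overrightarrow{\mathrm{Var}(l)}),\ U^\rho(x_1,x_1,\dots,x_k,x_k,\overrightarrow{\mathrm{Var}(l)})\to r\}$ for join rules with $k\ge1$, fresh $U^\rho$ and fresh distinct variables $x_i$; unconditional rules kept; both extended by union. A transformation $U$ is sound for $R$ over $\mathcal{F}$ if $s\to^*_{U(R)}t$ implies $s\to^*_Rt$ for all $s,t\in T(\mathcal{F},\mathcal{V})$, and sound w.r.t. EV-safe reduction if $s\to^*_{\mathrm{evs},U(R)}t$ implies $s\to^*_Rt$ for all such $s,t$. EV-safe reduction of an unconditional system $S$: for $t_0\to_{p_1,l_1\to r_1}t_1\to\cdots$ let $B_0=\mathrm{Pos}_{\mathcal{F}}(t_0)$, $B_i=(B_{i-1}\setminus\{q\in B_{i-1}\mid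 q\ge p_i\})\cup\{p_iq\mid q\in\mathrm{Pos}_{\mathcal{F}}(r_i)\}\cup\{p_ip'q\mid p_ipq\in B_{i-1},p\in\mathrm{Pos}_{\mathcal{V}}(l_i),l_i|_p=r_i|_{p'}\}$; EV-safe if $p_i\in B_{i-1}$ for all $i$; $\to^*_{\mathrm{evs},S}$: a finite EV-safe sequence exists. *)

(* Defs.v *)
(* MathComp with the sets of MathComp-Analysis's classical_sets. *)
From Stdlib Require List.
From Stdlib Require Import Relation_Operators.
From mathcomp Require Import all_boot.
From mathcomp Require Import boolp classical_sets.

Set Implicit Arguments.
Unset Strict Implicit.
Unset Printing Implicit Defensive.

Local Open Scope classical_set_scope.

Record signature := Signature { symb :> Type; arity : symb -> nat }.

(* T(F, V).  Arities are enforced by the type. *)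
Inductive term (F : signature) (V : Type) : Type :=
| Var (x : V)
| App (f : F) (a : {ffun 'I_(arity f) -> term F V}).
Arguments Var {F V} x.
Arguments App {F V} f a.

Section Terms.
Variables (F : signature) (V : eqType).
Implicit Types (s t : term F V) (p q : seq nat).

Definition is_var t : bool := if t is Var _ then true else false.

Fixpoint vars t : seq V :=
  match t with
  | Var x => [:: x]
  | App f a => flatten [seq vars (a i) | i <- enum 'I_(arity f)]
  end.

Definition ground t : Prop := vars t = [::].

Fixpoint subst (sigma : V -> term F V) t : term F V :=
  match t with
  | Var x => sigma x
  | App f a => App f [ffun i => subst sigma (a i)]
  end.

(* Positions are sequences of argument indices, counted from 0. *)
Fixpoint subterm t p {struct p} : option (term F V) :=
  match p with
  | [::] => Some t
  | i :: q =>
    match t with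
    | Var _ => None
    | App f a => if insub i is Some j then subterm (a j) q else None
    end
  end.

Definition Pos_fun t : set (seq nat) :=
  [set p | exists u, subterm t p = Some u /\ ~~ is_var u].

Definition Pos_var t : set (seq nat) :=
  [set p | exists x, subterm t p = Some (Var x)].

(* [CApp f i a C] has [C] as i-th argument; the value [a i] is ignored. *)
Inductive ctx : Type :=
| Hole
| CApp (f : F) (i : 'I_(arity f)) (a : {ffun 'I_(arity f) -> term F V})
       (C : ctx).

Fixpoint plug (C : ctx) t : term F V :=
  match C with
  | Hole => t
  | CApp f i a C' => App f [ffun j => if j == i then plug C' t else a j]
  end.

Fixpoint hole_pos (C : ctx) : seq nat :=
  match C with
  | Hole => [::]
  | CApp f i _ C' => val i :: hole_pos C'
  end.

(* [Cond Oriented s t] is s ->> t; [Cond Joinable s t] is s \downarrow t. *)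
Inductive ckind := Oriented | Joinable.
Record cond := Cond { kind : ckind; cleft : term F V; cright : term F V }.

(* An unconditional rule is a rule with an empty list of conditions. *)
Record crule :=
  CRule { lhs : term F V; rhs : term F V; conds : seq cond }.

Definition urule l r := CRule l r [::].

Definition oriented_rule (rho : crule) : Prop :=
  ~~ is_var (lhs rho) /\ forall c, List.In c (conds rho) -> kind c = Oriented.

Definition join_rule (rho : crule) : Prop :=
  ~~ is_var (lhs rho) /\ forall c, List.In c (conds rho) -> kind c = Joinable.

Definition rtc (rel : term F V -> term F V -> Prop) :=
  clos_refl_trans (term F V) rel.

Definition holds (rel : term F V -> term F V -> Prop)
    (sigma : V -> term F V) (c : cond) : Prop :=
  let s := subst sigma (cleft c) in
  let t := subst sigma (cright c) in
  match kind c with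
  | Oriented => rtc rel s t
  | Joinable => exists u, rtc rel s u /\ rtc rel t u
  end.

Fixpoint rstep_n (R : set crule) (n : nat) s t : Prop :=
  match n with
  | 0 => False
  | i.+1 => exists rho C sigma,
      [/\ R rho, s = plug C (subst sigma (lhs rho)),
          t = plug C (subst sigma (rhs rho)) &
          forall c, List.In c (conds rho) -> holds (rstep_n R i) sigma c]
  end.

Definition rstep (R : set crule) s t : Prop := exists n, rstep_n R n s t.

Definition rsteps (R : set crule) := rtc (rstep R).

Definition normal_form (R : set crule) s : Prop := forall t, ~ rstep R s t.

Definition uncond_part (R : set crule) : set crule :=
  [set urule (lhs rho) (rhs rho) | rho in R].

Definition normal_ctrs (R : set crule) : Prop :=
  forall rho, R rho -> oriented_rule rho /\
    forall c, List.In c (conds rho) ->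
      [/\ {subset vars (cleft c) <= vars (lhs rho)},
          ground (cright c) & normal_form (uncond_part R) (cright c)].

Definition to_join (rho : crule) : crule :=
  CRule (lhs rho) (rhs rho)
        [seq Cond Joinable (cleft c) (cright c) | c <- conds rho].

Definition join_ctrs_of (R : set crule) : set crule := to_join @` R.

Lemma join_ctrs_of_join (R : set crule) rho :
  normal_ctrs R -> join_ctrs_of R rho -> join_rule rho.
Proof.
move=> hR [rho' /hR[[nv _] _] <-]; split=> //= c.
by elim: (conds rho') => //= c' cs IH [<-|/IH].
Qed.

(* EV-safe reduction; meant for sets of unconditional rules, and the
   conditions of the rules are ignored. *)

Definition ustep_at (p : seq nat) (rho : crule) s t : Prop :=
  exists C sigma, [/\ hole_pos C = p, s = plug C (subst sigma (lhs rho)) &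
                      t = plug C (subst sigma (rhs rho))].

Definition evs_update (B : set (seq nat)) (p : seq nat) (rho : crule)
    : set (seq nat) :=
  (B `\` [set q | prefix p q])
  `|` [set p ++ q | q in Pos_fun (rhs rho)]
  `|` [set w | exists v v' q,
         [/\ w = p ++ v' ++ q, B (p ++ v ++ q), Pos_var (lhs rho) v &
             subterm (lhs rho) v = subterm (rhs rho) v']].

(* [evs_from S B s t]: a reduction from s to t that is EV-safe when B is the
   set of positions attached to s. *)
Inductive evs_from (S : set crule) :
    set (seq nat) -> term F V -> term F V -> Prop :=
| evs_refl B t : evs_from S B t t
| evs_step B s u t p rho :
    S rho -> ustep_at p rho s u -> B p ->
    evs_from S (evs_update B p rho) u t -> evs_from S B s t.

Definition evs_steps (S : set crule) s t : Prop := evs_from S (Pos_fun s) s t.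

End Terms.

Arguments Hole {F V}.

Section Unravelings.
Variables (F : signature) (V : eqType).
Implicit Types (rho : crule F V) (R : set (crule F V)).

(* Both unravelings replace a conditional rule rho : l -> r <= c by
     l -> U^rho(uin rho)   and   U^rho(uout rho) -> r
   and differ only in the two lists of arguments of U^rho. *)
Record unraveling := Unraveling {
  uin : crule F V -> seq (term F V);
  uout : crule F V -> seq (term F V) }.

Definition conditional R : set (crule F V) :=
  [set rho | R rho /\ (0 < size (conds rho))%N].

(* The signature F extended with one fresh symbol U^rho for each conditional
   rule rho of R; freshness comes from the disjoint sum. *)
Definition usig (U : unraveling) R : signature :=
  @Signature (symb F + set_type (conditional R))%type
    (fun g => match g with
              | inl f => arity f
              | inr rho => size (uin U (val rho))
              end).

Fixpoint embed (U : unraveling) R (t : term F V) : term (usig U R) V :=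
  match t with
  | Var x => Var x
  | App f a => @App (usig U R) V (inl f) [ffun i => embed U R (a i)]
  end.

(* U^rho(ts), for ts of length [size (uin U rho)]; under that assumption the
   default value [embed U R (lhs rho)] is never used. *)
Definition uapp (U : unraveling) R (rho : set_type (conditional R))
    (ts : seq (term F V)) : term (usig U R) V :=
  @App (usig U R) V (inr rho)
    [ffun i => nth (embed U R (lhs (val rho))) (map (embed U R) ts) (val i)].

Definition unravel (U : unraveling) R : set (crule (usig U R) V) :=
  [set urule (embed U R (lhs rho)) (embed U R (rhs rho))
     | rho in [set rho | R rho /\ conds rho = [::]]]
  `|` [set rho' | exists rho : set_type (conditional R),
         rho' = urule (embed U R (lhs (val rho)))
                      (uapp U rho (uin U (val rho)))
      \/ rho' = urule (uapp U rho (uout U (val rho)))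
                      (embed U R (rhs (val rho)))].

Definition sound (U : unraveling) R : Prop :=
  forall s t : term F V,
    rsteps (@unravel U R) (embed U R s) (embed U R t) -> rsteps R s t.

Definition sound_evs (U : unraveling) R : Prop :=
  forall s t : term F V,
    evs_steps (@unravel U R) (embed U R s) (embed U R t) -> rsteps R s t.

(* [vl l] is a listing of Var(l), for every term l. *)
Definition var_listing (vl : term F V -> seq V) : Prop :=
  forall l, uniq (vl l) /\ vl l =i vars l.

Definition rule_vars rho : seq V :=
  vars (lhs rho) ++ vars (rhs rho) ++
  flatten [seq vars (cleft c) ++ vars (cright c) | c <- conds rho].

(* [xs rho] is the list x_1, ..., x_k of variables used to unravel rho. *)
Definition fresh_vars R (xs : crule F V -> seq V) : Prop :=
  forall rho, R rho ->
    [/\ size (xs rho) = size (conds rho), uniq (xs rho) &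
        {in xs rho, forall x, x \notin rule_vars rho}].

Definition UN (vl : term F V -> seq V) : unraveling := {|
  uin rho := [seq cleft c | c <- conds rho] ++ map Var (vl (lhs rho));
  uout rho := [seq cright c | c <- conds rho] ++ map Var (vl (lhs rho)) |}.

Definition UJ (vl : term F V -> seq V) (xs : crule F V -> seq V)
    : unraveling := {|
  uin rho := flatten [seq [:: cleft c; cright c] | c <- conds rho]
             ++ map Var (vl (lhs rho));
  uout rho := flatten [seq [:: Var x; Var x] | x <- xs rho]
              ++ map Var (vl (lhs rho)) |}.

Lemma size_uout_UN vl rho : size (uout (UN vl) rho) = size (uin (UN vl) rho).
Proof. by rewrite !size_cat !size_map. Qed.

Lemma size_uout_UJ vl xs rho :
  size (xs rho) = size (conds rho) ->
  size (uout (UJ vl xs) rho) = size (uin (UJ vl xs) rho).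
Proof.
move=> e; rewrite !size_cat !size_flatten /shape -!map_comp; congr addn.
by elim: (xs rho) (conds rho) e => [|x s IH] [|c s'] //= [/IH ->].
Qed.

End Unravelings.

Arguments unravel {F V} U R.

(* Main.v *)
(** Interleaving the arguments of [U^rho] with the normal forms [n_i] maps
    [U^rho(s_1, ..., s_k, vs)] to [U^rho'(s_1, n_1, ..., s_k, n_k, vs)], and
    turns each step of the unraveling of [R] by [UN] into one step of the
    unraveling of [R'] by [UJ].  The positions of a term embed into those of
    its image, and the sets [B_i] of EV-safety are carried along this
    embedding, so EV-safe reductions are mapped to EV-safe reductions.
    Conversely, a step of [R'] is a step of [R], since a common reduct of
    [s_i sigma] and the ground normal form [n_i] can only be [n_i]. *)
Require Import Defs.
From Stdlib Require Import Relation_Operators Operators_Properties.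
From mathcomp Require Import all_boot.
From mathcomp Require Import boolp classical_sets.

(** * Substitution, subterms and positions *)

Section TermLemmas.
Set Implicit Arguments.
Unset Strict Implicit.
Variables (F : signature) (V : eqType).
Implicit Types (t u : term F V) (p q : seq nat).

Lemma term_ffun_ind (P : term F V -> Prop) :
  (forall x, P (Var x)) ->
  (forall f (a : {ffun 'I_(arity f) -> term F V}),
     (forall i, P (a i)) -> P (App f a)) ->
  forall t, P t.
Proof.
move=> HV HA; fix IH 1 => -[x|f a]; first exact: HV.
by apply: HA => i; apply: IH.
Qed.

Lemma vars_arg f (a : {ffun 'I_(arity f) -> term F V}) i :
  {subset vars (a i) <= vars (App f a)}.
Proof.
by move=> x xa; apply/flatten_mapP; exists i => //; rewrite mem_enum.
Qed.

Lemma eq_in_subst (sigma tau : V -> term F V) t :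
  {in vars t, sigma =1 tau} -> subst sigma t = subst tau t.
Proof.
elim/term_ffun_ind: t => [x|f a IH] st /=; first by apply: st; rewrite inE.
congr App; apply/ffunP => i; rewrite !ffunE; apply: IH => x xa.
exact/st/vars_arg/xa.
Qed.

Lemma subst_App sigma f (a : {ffun 'I_(arity f) -> term F V}) :
  subst sigma (App f a) = App f [ffun i => subst sigma (a i)].
Proof. by []. Qed.

Lemma subst_Var t : subst Var t = t.
Proof.
elim/term_ffun_ind: t => [//|f a IH] /=.
by congr App; apply/ffunP => i; rewrite !ffunE.
Qed.

Lemma subst_ground (sigma : V -> term F V) t : ground t -> subst sigma t = t.
Proof. by move=> t0; rewrite -[RHS]subst_Var; apply: eq_in_subst; rewrite t0. Qed.

Lemma subterm_cat t p q :
  subterm t (p ++ q) = obind (fun u => subterm u q) (subterm t p).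
Proof.
elim: p t => [//|i p IH] [//|f a] /=.
by case: insubP => [j _ _|_] //=.
Qed.

Lemma subterm_subst (sigma : V -> term F V) t p u :
  subterm t p = Some u -> subterm (subst sigma t) p = Some (subst sigma u).
Proof.
elim: p t => [|i p IH] t /=; first by case=> <-.
case: t => [//|f a] /=.
by case: insubP => [j _ _|_] //=; rewrite ffunE; apply: IH.
Qed.

Lemma vars_subterm t p u : subterm t p = Some u -> {subset vars u <= vars t}.
Proof.
elim: p t => [|i p IH] t /=; first by case=> <-.
case: t => [//|f a] /=.
case: insubP => [j _ _|_] //= /IH s x /s; exact: vars_arg.
Qed.

Lemma subterm_plug (C : ctx F V) t : subterm (plug C t) (hole_pos C) = Some t.
Proof.
by elim: C => [//|f i a C IH] /=; rewrite valK ffunE eqxx.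
Qed.

End TermLemmas.

(** * Terms translated by moving and filling arguments *)

Section Translation.
Set Implicit Arguments.
Unset Strict Implicit.
Variables (G H : signature) (V : eqType).
Variables (sm : G -> H) (pos : forall g, 'I_(arity g) -> 'I_(arity (sm g))).
(** [slot] inverts [pos] on its image and supplies a filler term elsewhere. *)
Variable slot : forall g, 'I_(arity (sm g)) -> 'I_(arity g) + term H V.
Hypothesis slot_pos : forall g i, slot (pos i) = inl i :> ('I_(arity g) + _).
Hypothesis slot_inl : forall g (j : 'I_(arity (sm g))) i,
  slot j = inl i -> j = pos i.
Hypothesis slot_ground : forall g (j : 'I_(arity (sm g))) n,
  slot j = inr n -> ground n.

(* The argument [i] of [g] moves to [pos i]; an argument of [sm g] that does
   not come from [g] is filled with a ground term. *)
Fixpoint tr (t : term G V) : term H V :=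
  match t with
  | Var x => Var x
  | App g a =>
    App (sm g) [ffun j => match slot j with inl i => tr (a i) | inr n => n end]
  end.

(* Only meaningful on positions [q] of [t]. *)
Fixpoint trpos (t : term G V) (q : seq nat) {struct q} : seq nat :=
  match q with
  | [::] => [::]
  | i :: q' =>
    match t with
    | Var _ => q
    | App g a =>
      if insub i is Some j then val (pos j) :: trpos (a j) q' else q
    end
  end.

Fixpoint trctx (C : ctx G V) : ctx H V :=
  match C with
  | Hole => Hole
  | CApp g i a C' =>
    @CApp H V (sm g) (pos i)
      [ffun j => match slot j with inl i => tr (a i) | inr n => n end] (trctx C')
  end.

Lemma pos_inj g : injective (@pos g).
Proof. by move=> i j ij; have := slot_pos i; rewrite ij slot_pos => -[]. Qed.

Lemma tr_App g a : tr (App g a) =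
  App (sm g) [ffun j => match slot j with inl i => tr (a i) | inr n => n end].
Proof. by []. Qed.

(** The fillers are ground, hence fixed by every substitution. *)
Lemma tr_subst sigma t : tr (subst sigma t) = subst (tr \o sigma) (tr t).
Proof.
elim/term_ffun_ind: t => [//|g a IH] /=.
congr App; apply/ffunP => j; rewrite !ffunE.
case jn: (slot j) => [i|n]; first by rewrite ffunE.
by rewrite subst_ground //; apply: slot_ground jn.
Qed.

Lemma tr_plug C t : tr (plug C t) = plug (trctx C) (tr t).
Proof.
elim: C => [//|g i a C IH] /=.
congr App; apply/ffunP => j; rewrite !ffunE.
case: eqP => [->|ji]; first by rewrite slot_pos ffunE eqxx.
case ji': (slot j) => [k|//]; rewrite ffunE; case: eqP => // ki.
by case: ji; rewrite (slot_inl ji') ki.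
Qed.

Lemma hole_pos_trctx C t : hole_pos (trctx C) = trpos (plug C t) (hole_pos C).
Proof.
by elim: C => [//|g i a C IH] /=; rewrite valK ffunE eqxx IH.
Qed.

Lemma subterm_tr t q u :
  subterm t q = Some u -> subterm (tr t) (trpos t q) = Some (tr u).
Proof.
elim: q t => [|i q IH] t /=; first by case=> <-.
case: t => [//|g a] /=.
case: insubP => [j _ _|_] //= tu.
by rewrite valK ffunE slot_pos; apply: IH.
Qed.

Lemma trpos_cat t p q u :
  subterm t p = Some u -> trpos t (p ++ q) = trpos t p ++ trpos u q.
Proof.
elim: p t => [|i p IH] t /=; first by case=> <-.
case: t => [//|g a] /=.
by case: insubP => [j _ _|_] //= /IH ->.
Qed.

Lemma trpos_subst sigma t q u :
  subterm t q = Some u -> trpos (subst sigma t) q = trpos t q.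
Proof.
elim: q t => [|i q IH] [x|g a] //=.
by case: insubP => [j _ _|_] //= /IH; rewrite ffunE => ->.
Qed.

(** Injectivity of [pos] makes the translation reflect the prefix order too, so a position that
    survives a step is not deleted after translation. *)
Lemma trpos_prefix t p q :
  isSome (subterm t p) -> isSome (subterm t q) ->
  prefix (trpos t p) (trpos t q) = prefix p q.
Proof.
elim: p t q => [|i p IH] [x|g a] [|i' q] //=; rewrite ?prefix0s //.
  by case: insubP => [j _ _|_].
case: insubP => [j _ <-|_] //=; case: insubP => [j' _ <-|_] //= pj qj.
rewrite !(inj_eq val_inj) (inj_eq (@pos_inj g)).
by case: eqP => // jj; rewrite jj /= IH // -jj.
Qed.

(** Such a [q] is a proper prefix of the hole position or branches off from it, so its path never
    enters the replaced subterm. *)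
Lemma trpos_plug C t u q : ~~ prefix (hole_pos C) q ->
  isSome (subterm (plug C t) q) ->
  isSome (subterm (plug C u) q) /\ trpos (plug C u) q = trpos (plug C t) q.
Proof.
elim: C q => [|g i a C IH] [|i' q] //=; case: insubP => [j _ <-|_] //=.
rewrite !ffunE [j == i]eq_sym val_eqE; case: eqP => //= _ hp st.
by have [? ->] := IH _ hp st.
Qed.

(* [lhs rho'] need not be [tr (lhs rho)]: [UJ] has the pattern
   [U(x_1, x_1, ...)] where [UN] has [U(n_1, ...)]. *)
Record simulates (rho : crule G V) (rho' : crule H V) : Prop := Simulates {
  sim_rhs : rhs rho' = tr (rhs rho);
  sim_inst : forall sigma, exists tau,
    tr (subst sigma (lhs rho)) = subst tau (lhs rho') /\
    tr (subst sigma (rhs rho)) = subst tau (rhs rho');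
  sim_var : forall v x, subterm (lhs rho) v = Some (Var x) ->
    subterm (lhs rho') (trpos (lhs rho) v) = Some (Var x) }.

Lemma simulates_tr l r : simulates (urule l r) (urule (tr l) (tr r)).
Proof.
split=> //= [sigma|v x /subterm_tr //].
by exists (tr \o sigma); rewrite !tr_subst.
Qed.

(** * Transfer of plain and EV-safe reductions *)

Variables (S : set (crule G V)) (S' : set (crule H V)).
Hypothesis S_sim : forall rho, S rho -> exists2 rho', S' rho' & simulates rho rho'.
Hypothesis S'_uncond : forall rho', S' rho' -> conds rho' = [::].

Lemma rsteps_tr s t : rsteps S s t -> rsteps S' (tr s) (tr t).
Proof.
elim=> {s t} [s t [[//|n] /= [rho [C [sigma [Srho -> -> _]]]]]|s|s t u _ st _ tu].
(* The rules of [S'] have no conditions, so level 1 already contains the step. *)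
- apply: rt_step; exists 1; have [rho' Srho' sim] := S_sim Srho.
  have [tau [ltau rtau]] := sim_inst sim sigma.
  exists rho', (trctx C), tau; rewrite -ltau -rtau !tr_plug.
  by split=> // c; rewrite (S'_uncond Srho').
- exact: rt_refl.
- exact: rt_trans tu.
Qed.

(** Invariant along EV-safe reductions. An inclusion is enough, since a step only requires
    membership of its position; existence in [t] is recorded because [trpos] is meaningful only
    there. *)
Definition tr_posset (B : set (seq nat)) (t : term G V) (B' : set (seq nat)) :=
  forall q, B q -> isSome (subterm t q) /\ B' (trpos t q).

Lemma tr_posset_update B B' rho rho' C sigma : simulates rho rho' ->
  tr_posset B (plug C (subst sigma (lhs rho))) B' ->
  tr_posset (evs_update B (hole_pos C) rho) (plug C (subst sigma (rhs rho)))
            (evs_update B' (hole_pos (trctx C)) rho').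
Proof.
move=> sim BB' w [[[Bw /negP npw]|[q [u [ru nu]] <-]]|].
(* Positions not below the contracted one survive. *)
- have [tw B'w] := BB' _ Bw.
  have [uw eqw] := trpos_plug (subst sigma (rhs rho)) npw tw.
  split=> //; left; left; rewrite eqw; split=> //=; apply/negP.
  by rewrite (hole_pos_trctx C (subst sigma (lhs rho))) trpos_prefix // subterm_plug.
(* Function positions created by the right-hand side. *)
- have ru' := subterm_subst sigma ru.
  rewrite subterm_cat subterm_plug /= ru'; split=> //; left; right.
  exists (trpos (rhs rho) q).
    by exists (tr u); rewrite (sim_rhs sim) (subterm_tr ru); case: (u) nu.
  by rewrite (trpos_cat _ (subterm_plug _ _)) (trpos_subst _ ru) -hole_pos_trctx.
(* Positions inherited through a variable [x]: by [sim_var] and [sim_rhs], [x] also sits at the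
   translated positions of both sides of [rho'], and the rest [q] is translated inside [sigma x]. *)
- move=> [v [v' [q [-> Bq [x lv] rv']]]].
  have {}rv' : subterm (rhs rho) v' = Some (Var x) by rewrite -rv'.
  have [] := BB' _ Bq.
  have lv1 := subterm_subst sigma lv; have rv1 := subterm_subst sigma rv'.
  rewrite !subterm_cat !subterm_plug /= !subterm_cat lv1 rv1 /= => sq B'q.
  split=> //; right.
  exists (trpos (lhs rho) v), (trpos (rhs rho) v'), (trpos (sigma x) q).
  have lv' := sim_var sim lv.
  split.
  + rewrite (trpos_cat _ (subterm_plug _ _)) (trpos_cat _ rv1).
    by rewrite (trpos_subst _ rv') -hole_pos_trctx.
  + move: B'q; rewrite (trpos_cat _ (subterm_plug _ _)) (trpos_cat _ lv1).
    by rewrite (trpos_subst _ lv) -hole_pos_trctx.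
  + by exists x.
  + by rewrite lv' (sim_rhs sim) (subterm_tr rv').
Qed.

Lemma evs_from_tr B s t : evs_from S B s t ->
  forall B', tr_posset B s B' -> evs_from S' B' (tr s) (tr t).
Proof.
elim=> {B s t} [B t B' _|B s u t p rho Srho [C [sigma [<- -> ->]]] Bp _ IH B' BB'].
  exact: evs_refl.
have [rho' Srho' sim] := S_sim Srho.
have [tau [ltau rtau]] := sim_inst sim sigma.
apply: (@evs_step _ _ _ _ _ (tr (plug C (subst sigma (rhs rho)))) _
          (hole_pos (trctx C)) rho') => //.
- by exists (trctx C), tau; rewrite !tr_plug ltau rtau.
- by rewrite (hole_pos_trctx C (subst sigma (lhs rho))); have [] := BB' _ Bp.
- exact/IH/tr_posset_update.
Qed.

Lemma evs_steps_tr s t : evs_steps S s t -> evs_steps S' (tr s) (tr t).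
Proof.
move/evs_from_tr; apply=> q [u [su nu]]; rewrite su; split=> //.
by exists (tr u); rewrite (subterm_tr su); case: (u) nu.
Qed.

End Translation.

(** * The translation between the two unravelings *)

Section NormalToJoin.
Set Implicit Arguments.
Unset Strict Implicit.
Variables (F : signature) (V : eqType) (R : set (crule F V)).
Variables (vl : term F V -> seq V) (xs : crule F V -> seq V).
Hypotheses (hR : normal_ctrs R) (hvl : var_listing vl).
Hypothesis hxs : fresh_vars (join_ctrs_of R) xs.

Local Notation R' := (join_ctrs_of R).
Local Notation UN := (UN vl).
Local Notation UJ := (UJ vl xs).
Local Notation FN := (usig UN R).
Local Notation FJ := (usig UJ R').

Section Embed.
Variables (U : unraveling F V) (Q : set (crule F V)).

Lemma vars_embed (t : term F V) : vars (embed U Q t) = vars t.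
Proof.
elim/term_ffun_ind: t => [//|f a IH] /=; congr flatten.
by apply: eq_map => i; rewrite ffunE.
Qed.

Lemma conds_unravel rho : unravel U Q rho -> conds rho = [::].
Proof. by case=> [[rho' _ <-]|[rho' [->|->]]]. Qed.

End Embed.

Lemma conditional_to_join (rho : set_type (conditional R)) :
  conditional R' (to_join (val rho)).
Proof.
case: rho => rho /= /set_mem[Rrho c0]; split; first by exists rho.
by rewrite size_map.
Qed.

Definition join_index (rho : set_type (conditional R)) :
    set_type (conditional R') :=
  exist _ (to_join (val rho)) (mem_set (conditional_to_join rho)).

Lemma R_val (rho : set_type (conditional R)) : R (val rho).
Proof. by case: rho => rho /= /set_mem[]. Qed.

(** * Arithmetic of the interleaved argument lists *)

Lemma size_uin_UN rho :
  size (uin UN rho) = (size (conds rho) + size (vl (lhs rho)))%N.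
Proof. by rewrite size_cat !size_map. Qed.

Lemma size_flatten_pairs (T A : Type) (f g : A -> T) (s : seq A) :
  size (flatten [seq [:: f a; g a] | a <- s]) = (size s).*2.
Proof. by elim: s => //= a s ->. Qed.

Lemma size_uin_UJ rho :
  size (uin UJ (to_join rho)) = ((size (conds rho)).*2 + size (vl (lhs rho)))%N.
Proof. by rewrite size_cat size_flatten_pairs !size_map. Qed.

(* Index, in [s_1, n_1, ..., s_k, n_k, vs], of the [i]-th element of
   [s_1, ..., s_k, vs]. *)
Definition interleave (k i : nat) : nat := if i < k then i.*2 else (i + k)%N.

(** One more pair in front shifts both sides consistently, as [interleave k.+1 i.+1] is
    [interleave k i] plus two. Arbitrary [f] and [g] cover the pairs [s_i, n_i] as well as
    [x_i, x_i]. *)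
Lemma nth_interleave (T A : Type) (f g : A -> T) (s : seq A) tl x i :
  nth x (flatten [seq [:: f a; g a] | a <- s] ++ tl) (interleave (size s) i) =
  nth x (map f s ++ tl) i.
Proof.
rewrite /interleave; elim: s i => [|a s IH] [|i] //=; first by rewrite addn0.
by rewrite addnS -IH ltnS; case: ifP.
Qed.

Lemma nth_interleave_odd (T A : Type) (f g : A -> T) (s : seq A) tl x i :
  i < size s ->
  nth x (flatten [seq [:: f a; g a] | a <- s] ++ tl) i.*2.+1 = nth x (map g s) i.
Proof. by elim: s i => [|a s IH] [|i] //= /IH. Qed.

Lemma interleave_bound rho (i : 'I_(size (uin UN rho))) :
  interleave (size (conds rho)) i < size (uin UJ (to_join rho)).
Proof.
rewrite size_uin_UJ /interleave; case: (ltnP i (size _)) => ik.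
  by rewrite ltn_addr // ltn_double.
by rewrite -addnn -addnA [X in _ < X]addnC ltn_add2r -size_uin_UN.
Qed.

(** Indices below [k] have values below [k.*2], the others at least [k.*2], and each branch is
    injective. *)
Lemma interleave_inj k : injective (interleave k).
Proof.
move=> i j; rewrite /interleave; case: ltnP => ik; case: ltnP => jk ij.
- exact: double_inj.
- by move: ik; rewrite -ltn_double ij -addnn ltn_add2r ltnNge jk.
- by move: jk; rewrite -ltn_double -ij -addnn ltn_add2r ltnNge ik.
- exact: addIn ij.
Qed.

Definition sym_NJ (g : FN) : FJ :=
  match g with inl f => inl f | inr rho => inr (join_index rho) end.

Definition pos_NJ (g : FN) : 'I_(arity g) -> 'I_(arity (sym_NJ g)) :=
  match g as h return 'I_(@arity FN h) -> 'I_(arity (sym_NJ h)) with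
  | inl f => id
  | inr rho => fun i : 'I_(size (uin UN (val rho))) =>
                 Ordinal (interleave_bound i)
  end.

(** [pick] searches for a preimage under [pos_NJ]. Without one, [j] is the index [i.*2.+1] of some
    [n_i] (counting from 0), so [j./2] recovers [i] and the default of [nth] is never reached. *)
Definition slot_NJ (g : FN) :
    'I_(arity (sym_NJ g)) -> 'I_(arity g) + term FJ V :=
  match g as h return 'I_(arity (sym_NJ h)) -> 'I_(@arity FN h) + term FJ V with
  | inl f => inl
  | inr rho => fun j =>
      if [pick i | @pos_NJ (inr rho) i == j] is Some i then inl i
      else inr (embed UJ R' (nth (lhs (val rho))
                 [seq cright c | c <- conds (val rho)] j./2))
  end.

Lemma pos_NJ_inj g : injective (@pos_NJ g).
Proof.
by case: g => [f//|rho] i j /(congr1 val) /interleave_inj /val_inj.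
Qed.

Lemma slot_pos_NJ g i : slot_NJ (pos_NJ i) = inl i :> ('I_(arity g) + _).
Proof.
case: g i => [//|rho] i; rewrite /slot_NJ; case: pickP => [j /eqP/pos_NJ_inj->//|].
by move/(_ i); rewrite eqxx.
Qed.

Lemma slot_inl_NJ g (j : 'I_(arity (sym_NJ g))) i :
  slot_NJ j = inl i -> j = pos_NJ i.
Proof.
case: g j i => [f j i [->]//|rho] j i; rewrite /slot_NJ.
by case: pickP => // i' /eqP <- [->].
Qed.

(** With [k] conditions, an index from [k.*2] on is the image of [j - k], and an even index below
    [k.*2] is the image of [j./2]; only the odd ones below [k.*2] remain. *)
Lemma slot_inr_NJ (rho : set_type (conditional R))
    (j : 'I_(arity (sym_NJ (inr rho)))) n :
  slot_NJ j = inr n -> exists i, [/\ i < size (conds (val rho)), val j = i.*2.+1 &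
    n = embed UJ R' (nth (lhs (val rho)) [seq cright c | c <- conds (val rho)] i)].
Proof.
rewrite /slot_NJ; case: pickP => // npos [<-]; set k := size _.
have jlt : j < k.*2 + size (vl (lhs (val rho))) by rewrite -size_uin_UJ.
have [jk|kj] := ltnP j k.*2.
  have hk : j./2 < k.
    by rewrite -ltn_double (leq_ltn_trans _ jk) // -[X in _ <= X]odd_double_half leq_addl.
  exists j./2; split=> //.
  rewrite -[LHS]odd_double_half; case jodd: (odd j) => //.
  have hi : j./2 < size (uin UN (val rho)).
    by rewrite size_uin_UN (leq_trans hk) // leq_addr.
  have := npos (Ordinal hi); rewrite -val_eqE /= /interleave hk.
  by rewrite -[X in _ == X]odd_double_half jodd eqxx.
have hi : j - k < size (uin UN (val rho)).
  rewrite size_uin_UN -/k ltn_subLR; first by rewrite addnA addnn.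
  by rewrite (leq_trans _ kj) // -addnn leq_addr.
have := npos (Ordinal hi); rewrite -val_eqE /= /interleave -/k ltn_subLR.
  rewrite addnn ltnNge kj /= subnK ?eqxx //.
  by rewrite (leq_trans _ kj) // -addnn leq_addr.
by rewrite (leq_trans _ kj) // -addnn leq_addr.
Qed.

Lemma ground_nth_cright rho i : R rho -> i < size (conds rho) ->
  ground (nth (lhs rho) [seq cright c | c <- conds rho] i).
Proof.
move=> /hR[_]; elim: (conds rho) i => [//|c cs IH] [|i] /= hc.
  by have [] := hc c (or_introl erefl).
by apply: IH => c' c'cs; apply: hc; right.
Qed.

Lemma slot_ground_NJ g (j : 'I_(arity (sym_NJ g))) n :
  slot_NJ j = inr n -> ground n.
Proof.
case: g j => [//|rho] j /slot_inr_NJ [i [ik _ ->]].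
by rewrite /ground vars_embed; apply/ground_nth_cright/ik/R_val.
Qed.

(** * Simulation of the rules *)

Local Notation tr_NJ := (@tr FN FJ V sym_NJ slot_NJ).

(** Symbols of [F] keep all their arguments in place, so the terms that soundness speaks of are
    unaffected. *)
Lemma tr_embed t : tr_NJ (embed UN R t) = embed UJ R' t.
Proof.
elim/term_ffun_ind: t => [//|f a IH] /=.
by congr App; apply/ffunP => i; rewrite !ffunE IH.
Qed.

Lemma nth_uin rho x i :
  nth x (uin UJ (to_join rho)) (interleave (size (conds rho)) i) =
  nth x (uin UN rho) i.
Proof.
by rewrite -[size (conds rho)](size_map (fun c => Cond Joinable (cleft c) (cright c)))
  nth_interleave /= -map_comp.
Qed.

Lemma nth_uin_odd rho x i : i < size (conds rho) ->
  nth x (uin UJ (to_join rho)) i.*2.+1 = nth x [seq cright c | c <- conds rho] i.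
Proof. by move=> ik; rewrite nth_interleave_odd ?size_map //= -map_comp. Qed.

Lemma R'_to_join rho : R rho -> R' (to_join rho).
Proof. by move=> Rrho; exists rho. Qed.

(** The fillers are the [n_i] that [uin UJ] pairs with the [s_i], so the rule introducing [U^rho] is
    translated literally. *)
Lemma tr_uapp_uin (rho : set_type (conditional R)) :
  tr_NJ (uapp UN rho (uin UN (val rho))) =
  uapp UJ (join_index rho) (uin UJ (to_join (val rho))).
Proof.
rewrite /uapp tr_App; congr App; apply/ffunP => j; rewrite !ffunE.
rewrite (nth_map (lhs (val rho))); last exact: ltn_ord.
case E: (slot_NJ j) => [i|n].
  rewrite (slot_inl_NJ E) ffunE (nth_map (lhs (val rho))) ?ltn_ord //.
  by rewrite nth_uin tr_embed.
have [i [ik -> ->]] := slot_inr_NJ E.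
by rewrite nth_uin_odd.
Qed.

(** [V] may be empty, so a default variable for [nth] has to come from a nonempty list. *)
Lemma elt_of_size (T : Type) (s : seq T) i : i < size s -> T.
Proof. by case: s. Qed.

(* The fresh variables [x_i] are instantiated by [n_i].  As the [n_i] are
   ground, the variables of the left-hand side occur only in the listing. *)
Lemma sim_uout (rho : set_type (conditional R)) :
  simulates pos_NJ slot_NJ
    (urule (uapp UN rho (uout UN (val rho))) (embed UN R (rhs (val rho))))
    (urule (uapp UJ (join_index rho) (uout UJ (to_join (val rho))))
           (embed UJ R' (rhs (val rho)))).
Proof.
set r := val rho; have Rr : R r := R_val rho.
have [sxs uxs fxs] := hxs (R'_to_join Rr); rewrite size_map in sxs.
have sN : size (uout UN r) = size (uin UN r) := size_uout_UN vl r.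
have sJ : size (uout UJ (to_join r)) = size (uin UJ (to_join r)).
  by apply: size_uout_UJ; rewrite sxs size_map.
(* Freshness also covers extra variables of [rhs r]; on the variables of both sides, the
   substitution chosen below agrees with [tr_NJ \o sigma]. *)
have xsF x : x \in vars (lhs r) ++ vars (rhs r) -> x \in xs (to_join r) = false.
  by move=> xlr; apply/negP => /fxs; rewrite /rule_vars catA mem_cat xlr.
split=> [|sigma|v x].
- by rewrite /= tr_embed.
- exists (fun x => if x \in xs (to_join r)
    then embed UJ R' (nth (lhs r) [seq cright c | c <- conds r]
                        (index x (xs (to_join r))))
    else tr_NJ (sigma x)); split; last first.
    rewrite [LHS]tr_subst ?tr_embed; last exact: slot_ground_NJ.
    apply: eq_in_subst => x; rewrite vars_embed => xr.
    by rewrite xsF // mem_cat xr orbT.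
  rewrite [lhs _]/= [lhs (urule (uapp UJ _ _) _)]/= /uapp !subst_App tr_App.
  congr App; apply/ffunP => j; rewrite !ffunE.
  rewrite (nth_map (lhs r)) ?sJ ?ltn_ord //.
  case E: (@slot_NJ (inr rho) j) => [i|n].
    rewrite (slot_inl_NJ E) !ffunE (nth_map (lhs r)) ?sN ?ltn_ord //=.
    rewrite -sxs nth_interleave !nth_cat !size_map sxs; case: ltnP => ik.
      have x0 : V by apply: (@elt_of_size _ (xs (to_join r)) i); rewrite sxs.
      rewrite (nth_map x0) ?sxs //= mem_nth ?sxs // index_uniq ?sxs //.
      rewrite subst_ground ?tr_embed // /ground vars_embed.
      exact: ground_nth_cright.
    have ivl : i - size (conds r) < size (vl (lhs r)).
      by rewrite ltn_subLR // -size_uin_UN.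
    have x0 : V := elt_of_size ivl.
    rewrite (nth_map x0) //= xsF // mem_cat -(hvl _).2.
    by rewrite mem_nth.
  (* The filled slots are those of the second copies of the [x_i]. *)
  have [i [ik -> ->]] := slot_inr_NJ E.
  have x0 : V by apply: (@elt_of_size _ (xs (to_join r)) i); rewrite sxs.
  rewrite nth_interleave_odd ?sxs // (nth_map x0) ?sxs //=.
  by rewrite mem_nth ?sxs // index_uniq ?sxs.
- case: v => [|i v] //=; case: insubP => [j _ _|] //=.
  rewrite (valK (Ordinal (interleave_bound j))) !ffunE.
  rewrite (nth_map (lhs r)) ?sN ?ltn_ord //.
  rewrite (nth_map (lhs r)) ?sJ ?ltn_ord //=.
  rewrite -sxs nth_interleave !nth_cat !size_map sxs; case: ltnP => jk.
    move/vars_subterm/(_ x); rewrite inE eqxx vars_embed => /(_ isT).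
    by rewrite ground_nth_cright.
  have jvl : j - size (conds r) < size (vl (lhs r)).
    by rewrite ltn_subLR // -size_uin_UN.
  have x0 : V := elt_of_size jvl.
  by rewrite !(nth_map x0) //; case: v => [|i0 v] /=; first case=> ->.
Qed.

Lemma unravel_simulated rho : unravel UN R rho ->
  exists2 rho', unravel UJ R' rho' & simulates pos_NJ slot_NJ rho rho'.
Proof.
have sim_tr := simulates_tr slot_pos_NJ slot_ground_NJ.
case=> [[r [Rr r0] <-]|[r [->|->]]].
- exists (urule (embed UJ R' (lhs r)) (embed UJ R' (rhs r))).
    left; exists (to_join r) => //; split; first exact: R'_to_join.
    by rewrite /= r0.
  by rewrite -!tr_embed; apply: sim_tr.
- exists (urule (embed UJ R' (lhs (val r)))
                (uapp UJ (join_index r) (uin UJ (to_join (val r))))).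
    by right; exists (join_index r); left.
  by rewrite -tr_embed -tr_uapp_uin; apply: sim_tr.
- exists (urule (uapp UJ (join_index r) (uout UJ (to_join (val r))))
                (embed UJ R' (rhs (val r)))).
    by right; exists (join_index r); right.
  exact: sim_uout.
Qed.

(** * Back from [R'] to [R] *)

Lemma rsteps_normal (S : set (crule F V)) n t :
  normal_form S n -> rsteps S n t -> t = n.
Proof.
move=> nfn /clos_rt_rt1n_iff nt.
by case: nt nfn => // u w nu _ /(_ u); case.
Qed.

Lemma rtc_sub (r1 r2 : term F V -> term F V -> Prop) s t :
  (forall s t, r1 s t -> r2 s t) -> rtc r1 s t -> rtc r2 s t.
Proof.
move=> r12; elim=> {s t} [s t /r12|s|s u t _ su _]; first exact: rt_step.
  exact: rt_refl.
exact: rt_trans.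
Qed.

(** Dropping conditions only adds steps, so a normal form of [uncond_part R] is irreducible at every
    level of [R]. *)
Lemma rstep_uncond n s t : rstep_n R n s t -> rstep (uncond_part R) s t.
Proof.
case: n => [//|n] [rho [C [sigma [Rrho -> -> _]]]]; exists 1.
by exists (urule (lhs rho) (rhs rho)), C, sigma; split=> //; exists rho.
Qed.

(** Induction on the level, since conditions are evaluated one level below: the hypothesis turns
    their reductions in [R'] into reductions in [R] at the same level. *)
Lemma rstep_n_join n s t : rstep_n R' n s t -> rstep_n R n s t.
Proof.
elim: n s t => [//|n IH] _ _ [_ [C [sigma [[rho Rrho <-] -> -> hc]]]].
exists rho, C, sigma; split=> // c cin.
have [[_ /(_ _ cin) ko] /(_ _ cin) [_ gr nf]] := hR Rrho.
have [|u [su ru]] := hc (Cond Joinable (cleft c) (cright c)).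
  exact: (List.in_map (fun c => Cond Joinable (cleft c) (cright c))).
rewrite /holds ko; rewrite /= subst_ground // in ru *.
have <- : u = cright c; last exact: rtc_sub su.
apply: rsteps_normal nf _; apply: rtc_sub ru => s' t' /IH.
exact: rstep_uncond.
Qed.

Lemma rsteps_join s t : rsteps R' s t -> rsteps R s t.
Proof. by apply: rtc_sub => s' t' [n /rstep_n_join]; exists n. Qed.

End NormalToJoin.

Theorem theorem5p15 (F : signature) (V : eqType) (R : set (crule F V))
    (vl : term F V -> seq V) (xs : crule F V -> seq V)
    (hR : normal_ctrs R)
    (hvl : var_listing vl)
    (hxs : fresh_vars (join_ctrs_of R) xs) :
  (sound (UJ vl xs) (join_ctrs_of R) -> sound (UN vl) R) /\
  (sound_evs (UJ vl xs) (join_ctrs_of R) -> sound_evs (UN vl) R).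
Proof.
have sim := unravel_simulated hR hvl hxs.
have un := @conds_unravel _ _ (UJ vl xs) (join_ctrs_of R).
have sp := @slot_pos_NJ _ _ R vl xs; have sl := @slot_inl_NJ _ _ R vl xs.
(* [tr_embed] exhibits the embedded endpoints as translations, so the translated reduction is one to
   which soundness of [UJ] applies. *)
split=> snd s t st; apply: (rsteps_join hR); apply: snd; rewrite -!tr_embed.
- exact: (rsteps_tr sp sl sim un).
- exact: (evs_steps_tr sp sl sim).
Qed.
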